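(* The formation of the support of a continuous valuation is a morphism of monads $\mathrm{supp}:(V,\delta,\mathcal{E})\to(H,\sigma,\mathcal{U})$ on $\mathsf{Top}$. That is, the maps $\mathrm{supp}_X:VX\to HX$, $\nu\mapsto\mathrm{supp}(\nu)$, are continuous and natural in the topological space $X$, and they satisfy $\mathrm{supp}_X\circ\delta_X=\sigma_X$ and $\mathrm{supp}_X\circ\mathcal{E}_X=\mathcal{U}_X\circ(\mathrm{supp}_X)_\sharp\circ\mathrm{supp}_{VX}$ for every topological space $X$.
   Context: $\mathsf{Top}$ is the category of all topological spaces and continuous maps; $\mathcal{O}(X)$ is the set of open subsets of $X$. The monad $H$. $HX$ is the set of all closed subsets of $X$ (including $\varnothing$) with the lower Vietoris topology, i.e. the topology generated by the sets $\{C\in HX: C\cap U\neq\varnothing\}$ for $U\in\mathcal{O}(X)$. For continuous $f:X\to Y$, $f_\sharp:HX\to HY$ is $f_\sharp C=\mathrm{cl}(f(C))$. The unit is $\sigma_X:X\to HX$, $\sigma(x)=\mathrm{cl}(\{x\})$, and the multiplication is $\mathcal{U}_X:HHX\to HX$, $\mathcal{U}(\mathcal{C})=\mathrm{cl}(\bigcup_{C\in\mathcal{C}}C)$. The monad $V$. $[0,\infty]$ carries the upper topology (open sets $\varnothing$, $[0,\infty]$ and $(r,\infty]$), and $[0,\infty]^X$ is the set of continuous (i.e. lower semicontinuous) maps $X\to[0,\infty]$, with pointwise order and algebra, $0\cdot\infty=0$. A continuous valuation on $X$ is a map $\nu:\mathcal{O}(X)\to[0,\infty]$ with $\nu(\varnothing)=0$,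 $\nu(U\cup W)+\nu(U\cap W)=\nu(U)+\nu(W)$, and $\nu(\bigcup_\lambda U_\lambda)=\sup_\lambda\nu(U_\lambda)$ for every directed net of open sets. For simple lower semicontinuous $f=\sum_i r_i1_{U_i}$ ($U_i$ open, $r_i\in(0,\infty]$, finite sum) put $\int f\,d\nu=\sum_ir_i\nu(U_i)$, and for $g\in[0,\infty]^X$ put $\langle\nu,g\rangle=\int g\,d\nu=\sup\{\int f\,d\nu: f\text{ simple lower semicontinuous}, f\le g\}$. Via $\nu\mapsto\langle\nu,-\rangle$, continuous valuations correspond bijectively to $[0,\infty]$-linear maps $[0,\infty]^X\to[0,\infty]$ preserving directed suprema. $VX$ is the set of continuous valuations with the weakest topology making $\nu\mapsto\langle\nu,g\rangle$ continuous for every $g\in[0,\infty]^X$. For continuous $f:X\to Y$, $f_*:VX\to VY$ is $(f_*\nu)(U)=\nu(f^{-1}(U))$. The unit is $\delta_X(x)(U)=1_U(x)$, and the multiplication $\mathcal{E}_X:VVX\to VX$ is given by $\langle\mathcal{E}\xi,g\rangle=\langle\xi,\ \rho\mapsto\langle\rho,g\rangle\rangle$. Support. For $\nu\in VX$, $\mathrm{supp}(\nu)\in HX$ is the closed set characterized by: for every open $U\subseteq X$, $\mathrm{supp}(\nu)\cap U\neq\varnothing$ if and only if $\nu(U)>0$. Equivalently, it is the complement of the largest open set of $\nu$-value $0$. *)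

(* Defs.v *)
From HB Require Import structures.
From mathcomp Require Import all_boot all_order all_algebra.
From mathcomp Require Import all_classical all_reals.
From mathcomp Require Import ereal numfun topology.

Set Implicit Arguments.
Unset Strict Implicit.
Unset Printing Implicit Defensive.
Import Order.TTheory GRing.Theory Num.Theory.

Local Open Scope classical_set_scope.
Local Open Scope ring_scope.
Local Open Scope ereal_scope.

(* [0, oo] with the upper topology *)
Record uereal (R : realType) : Type := UEreal {
  uereal_val :> \bar R;
  uereal_ge0 : 0 <= uereal_val }.

HB.instance Definition _ (R : realType) := [isSub for @uereal_val R].
HB.instance Definition _ (R : realType) := [Choice of uereal R by <:].

Section upper_topology.
Variable R : realType.

Definition upper_open (A : set (uereal R)) : Prop :=
  [\/ A = set0, A = setT |
      exists2 r : R, (0 <= r)%R & A = [set x | r%:E < x]].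

Lemma upper_openP (A : set (uereal R)) :
  (forall x, A x -> exists a : R, [/\ (0 <= a)%R, a%:E < x &
      forall y : uereal R, a%:E < y -> A y]) -> upper_open A.
Proof.
move=> H; have [->|/set0P[x0 Ax0]] := eqVneq A set0; first by constructor 1.
pose S := [set a : R | (0 <= a)%R /\ forall y : uereal R, a%:E < y -> A y].
have lS : has_lbound S by exists 0%R => a [].
have nS : S !=set0 by have [a [? _ ?]] := H _ Ax0; exists a.
constructor 3; exists (inf S); first by apply: lb_le_inf => // a [].
apply/seteqP; split => x /=.
  move=> /H[a [a0 ax Aa]]; apply: le_lt_trans ax.
  by rewrite lee_fin; apply: ge_inf.
case: x => [[x||] x_ge0] //= ix.
- have [a [a0 Sa] ax] : exists2 a, S a & (a < x)%R by apply: inf_lt.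
  exact: Sa.
- have [a [a0 Sa]] := nS; apply: Sa; exact: ltry.
Qed.

Lemma upper_open_nbhs (A : set (uereal R)) : upper_open A -> forall x, A x ->
  A = setT \/ exists a : R, [/\ (0 <= a)%R, a%:E < x &
      forall y : uereal R, a%:E < y -> A y].
Proof. by case => [->//|->|[r r0 ->]] x Ax; [left|right; exists r; split]. Qed.

Lemma upper_openT : upper_open setT. Proof. by constructor 2. Qed.

Lemma upper_openI : setI_closed upper_open.
Proof.
move=> A B oA oB.
have [->|/eqP AT] := eqVneq A setT; first by rewrite setTI.
have [->|/eqP BT] := eqVneq B setT; first by rewrite setIT.
apply: upper_openP => x [Ax Bx].
have [//|[a [a0 ax Aa]]] := upper_open_nbhs oA Ax.
have [//|[b [b0 bx Bb]]] := upper_open_nbhs oB Bx.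
exists (Num.max a b); split; first by rewrite le_max a0.
  by rewrite EFin_max gt_max ax bx.
by move=> y; rewrite EFin_max gt_max => /andP[/Aa ? /Bb ?]; split.
Qed.

Lemma upper_open_bigcup (I : Type) (F : I -> set (uereal R)) :
  (forall i, upper_open (F i)) -> upper_open (\bigcup_i F i).
Proof.
move=> oF; have [[i Fi]|nT] := pselect (exists i, F i = setT).
  by constructor 2; apply/seteqP; split => // x _; exists i => //; rewrite Fi.
apply: upper_openP => x [i _ Fix].
have [Fi|[a [a0 ax Aa]]] := upper_open_nbhs (oF i) Fix.
  by case: nT; exists i.
by exists a; split=> // y /Aa ?; exists i.
Qed.

HB.instance Definition _ := isOpenTopological.Build (uereal R)
  upper_openT upper_openI upper_open_bigcup.

End upper_topology.

(* Continuity into [uereal R] is lower semicontinuity. *)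
Notation lsc R X := (continuousType X (uereal R)).

Section opens_closeds.
Variable X : topologicalType.

Record opens : Type := Opens { opens_set :> set X; opensP : open opens_set }.
Record closeds : Type :=
  Closeds { closeds_set :> set X; closedsP : closed closeds_set }.

Lemma opens_eqP (U W : opens) : U = W :> set X -> U = W.
Proof.
by case: U W => [U oU] [W oW] /= E; subst W; congr Opens; exact: Prop_irrelevance.
Qed.

Lemma closeds_eqP (U W : closeds) : U = W :> set X -> U = W.
Proof.
case: U W => [U oU] [W oW] /= E; subst W.
by congr Closeds; exact: Prop_irrelevance.
Qed.

Definition opens0 : opens := Opens (@open0 X).
Definition opensU (U W : opens) : opens := Opens (openU (opensP U) (opensP W)).
Definition opensI (U W : opens) : opens := Opens (openI (opensP U) (opensP W)).
Definition opens_bigcup (D : set opens) : opens :=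
  Opens (bigcup_open (fun U (_ : D U) => opensP U)).

(* A directed net of opens enters the axiom of continuity only through its
   range, which is a nonempty directed set of opens. *)
Definition directed_opens (D : set opens) : Prop :=
  D !=set0 /\
  forall U W, D U -> D W -> exists2 Z, D Z & (U `<=` Z) /\ (W `<=` Z).

End opens_closeds.

Definition opens_preimage (X Y : topologicalType) (f : continuousType X Y)
    (U : opens Y) : opens X :=
  Opens (open_comp (fun x _ => @cts_fun X Y f x) (opensP U)).

HB.instance Definition _ (X : topologicalType) := gen_eqMixin (opens X).
HB.instance Definition _ (X : topologicalType) := gen_choiceMixin (opens X).

HB.instance Definition _ (X : topologicalType) := gen_eqMixin (closeds X).
HB.instance Definition _ (X : topologicalType) := gen_choiceMixin (closeds X).
(* lower Vietoris topology *)
HB.instance Definition _ (X : topologicalType) :=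
  isSubBaseTopological.Build (closeds X)
    (@open X) (fun U => [set C : closeds X | C `&` U !=set0]).

(* The action of H on a map f; it is functorial on continuous maps, but the
   formula does not need continuity. *)
Definition closeds_map (X Y : topologicalType) (f : X -> Y) (C : closeds X) :
  closeds Y := Closeds (@closed_closure Y (f @` C)).

Definition closeds_unit (X : topologicalType) (x : X) : closeds X :=
  Closeds (@closed_closure X [set x]).

Definition closeds_mult (X : topologicalType) (K : closeds (closeds X)) :
  closeds X := Closeds (@closed_closure X (\bigcup_(C in K) C)).

Record valuation (R : realType) (X : topologicalType) : Type := Valuation {
  valuation_fun :> opens X -> uereal R;
  valuation0 : valuation_fun (opens0 X) = 0 :> \bar R;
  valuation_modular : forall U W : opens X,
    valuation_fun (opensU U W) + valuation_fun (opensI U W) =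
    valuation_fun U + valuation_fun W :> \bar R;
  valuation_directed : forall D : set (opens X), directed_opens D ->
    valuation_fun (opens_bigcup D) =
    ereal_sup [set (valuation_fun U : \bar R) | U in D] :> \bar R }.

Section integral.
Variables (R : realType) (X : topologicalType).

(* A list of pairs (r, U) with 0 < r <= oo is a presentation of the simple lower
   semicontinuous function sum_i r_i 1_(U_i). *)
Definition simple_fun (s : seq (\bar R * opens X)) (x : X) : \bar R :=
  \sum_(p <- s) p.1 * (\1_(p.2 : set X) x)%:E.

Definition simple_integral (nu : valuation R X) (s : seq (\bar R * opens X)) :
  \bar R := \sum_(p <- s) p.1 * nu p.2.

Definition simple_below (g : lsc R X) : set (seq (\bar R * opens X)) :=
  [set s | all (fun p => 0 < p.1) s /\ forall x, simple_fun s x <= g x].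

Definition integral_val (nu : valuation R X) (g : lsc R X) : \bar R :=
  ereal_sup [set simple_integral nu s | s in simple_below g].

Lemma integral_val_ge0 nu g : 0 <= integral_val nu g.
Proof.
apply: le_ereal_sup_tmp; exists 0 => //; exists [::].
  by split=> // x; rewrite /simple_fun big_nil; exact: uereal_ge0.
by rewrite /simple_integral big_nil.
Qed.

Definition integral (nu : valuation R X) (g : lsc R X) : uereal R :=
  UEreal (integral_val_ge0 nu g).

End integral.

HB.instance Definition _ (R : realType) (X : topologicalType) :=
  gen_eqMixin (valuation R X).
HB.instance Definition _ (R : realType) (X : topologicalType) :=
  gen_choiceMixin (valuation R X).

HB.instance Definition _ (R : realType) (X : topologicalType) :=
  Topological.copy (valuation R X)
    (sup_topology (fun g : lsc R X =>
       Topological.class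
         (initial_topology (fun nu : valuation R X => integral nu g)))).

Lemma integral_continuous (R : realType) (X : topologicalType) (g : lsc R X) :
  continuous (fun nu : valuation R X => integral nu g).
Proof.
move=> nu.
pose Tc (g : lsc R X) := Topological.class
  (initial_topology (fun nu : valuation R X => integral nu g)).
have H : (nbhs nu : set_system (valuation R X)) --> (nu : sup_topology Tc).
  by [].
have Hg := (@cvg_sup _ _ Tc _ nu _).1 H g.
move=> A /= nA; apply: Hg.
exact: (@initial_continuous _ _ (fun nu : valuation R X => integral nu g) nu A).
Qed.

Section ereal_sup_lemmas.
Variable R : realType.

Lemma ereal_sup_ge0 (S : set (\bar R)) :
  S !=set0 -> (forall x, S x -> 0 <= x) -> 0 <= ereal_sup S.
Proof. by case=> x Sx S0; apply: le_ereal_sup_tmp; exists x => //; exact: S0. Qed.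

Lemma ereal_sup_dirD (T : Type) (D : set T) (u v : T -> \bar R) :
  D !=set0 -> (forall i, D i -> 0 <= u i) -> (forall i, D i -> 0 <= v i) ->
  (forall i j, D i -> D j -> exists k, [/\ D k, u i <= u k & v j <= v k]) ->
  ereal_sup [set u i + v i | i in D] =
  ereal_sup [set u i | i in D] + ereal_sup [set v i | i in D].
Proof.
move=> D0 u0 v0 dir; apply/eqP; rewrite eq_le; apply/andP; split.
  apply: ge_ereal_sup => _ [i Di <-].
  by apply: leeD; apply: ereal_sup_ubound; exists i.
set M := ereal_sup [set u i + v i | i in D].
have MP i j : D i -> D j -> u i + v j <= M.
  move=> Di Dj; have [k [Dk ik jk]] := dir i j Di Dj.
  by apply: le_ereal_sup_tmp; exists (u k + v k); [exists k|exact: leeD].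
have [x0 Dx0] := D0.
have su0 : 0 <= ereal_sup [set u i | i in D].
  by apply: ereal_sup_ge0 => [|_ [i Di <-]]; [exists (u x0), x0|exact: u0].
have sv0 : 0 <= ereal_sup [set v i | i in D].
  by apply: ereal_sup_ge0 => [|_ [i Di <-]]; [exists (v x0), x0|exact: v0].
have M0 : 0 <= M by apply: le_trans (MP _ _ Dx0 Dx0); rewrite adde_ge0 ?u0 ?v0.
have [->|Moo] := eqVneq M +oo; first exact: leey.
have Mfin : M \is a fin_num by rewrite ge0_fin_numE// lt_neqAle Moo leey.
have fu i : D i -> u i \is a fin_num.
  move=> Di; rewrite ge0_fin_numE ?u0//.
  apply: (@le_lt_trans _ _ M); last by rewrite -ge0_fin_numE.
  by apply: le_trans (MP i i Di Di); rewrite leeDl ?v0.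
have H1 i : D i -> u i + ereal_sup [set v i | i in D] <= M.
  move=> Di; rewrite -leeBrDl ?fu//; apply: ge_ereal_sup => _ [j Dj <-].
  by rewrite leeBrDl ?fu//; exact: MP.
have fsv : ereal_sup [set v i | i in D] \is a fin_num.
  rewrite ge0_fin_numE//; apply: (@le_lt_trans _ _ M); last by rewrite -ge0_fin_numE.
  by apply: le_trans (H1 _ Dx0); rewrite leeDr ?u0.
rewrite -leeBrDr//; apply: ge_ereal_sup => _ [i Di <-].
by rewrite leeBrDr//; exact: H1.
Qed.

Lemma ereal_sup_dir_sum (I T : Type) (s : seq I) (D : set T) (le : T -> T -> Prop)
    (u : I -> T -> \bar R) :
  D !=set0 -> (forall a i, D i -> 0 <= u a i) ->
  (forall a i j, D i -> D j -> le i j -> u a i <= u a j) ->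
  (forall i j, D i -> D j -> exists k, [/\ D k, le i k & le j k]) ->
  ereal_sup [set \sum_(a <- s) u a i | i in D] =
  \sum_(a <- s) ereal_sup [set u a i | i in D].
Proof.
move=> D0 u0 umono dir; elim: s => [|a s IH].
  rewrite big_nil; under eq_imagel do rewrite big_nil.
  by rewrite ereal_sup_cst//; apply/set0P.
rewrite big_cons -IH; under eq_imagel do rewrite big_cons.
apply: ereal_sup_dirD => //; first by move=> i Di; exact: u0.
  by move=> i Di; apply: sume_ge0 => b _; exact: u0.
move=> i j Di Dj; have [k [Dk ik jk]] := dir i j Di Dj.
by exists k; split => //; [exact: umono|apply: lee_sum => b _; exact: umono].
Qed.

End ereal_sup_lemmas.

Section valuation_lemmas.
Variables (R : realType) (X : topologicalType).
Implicit Types (nu : valuation R X) (U W : opens X) (s t : seq (opens X)).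

Lemma valuation_ge0 nu U : 0 <= nu U. Proof. exact: uereal_ge0. Qed.
Hint Resolve valuation_ge0 : core.

Lemma valuation_mono nu U W : U `<=` W -> nu U <= nu W.
Proof.
move=> UW; pose D := [set Z : opens X | Z = U \/ Z = W].
have dD : directed_opens D.
  split; first by exists U; left.
  move=> A B DA DB; exists W; first by right.
  by split; [case: DA => ->|case: DB => ->].
have <- : opens_bigcup D = W.
  apply: opens_eqP => /=; apply/seteqP; split => x.
    by case=> Z /= [->|->]//; exact: UW.
  by exists W => //; right.
rewrite valuation_directed//; apply: ereal_sup_ubound.
by exists U => //; left.
Qed.

(* Modularity turns a list of opens U_1, ..., U_n into the decreasing chain whose
   k-th member is the set of points lying in more than k of the U_i, without
   changing the sum of the values. This gives monotonicity of the integral of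
   simple functions even when the valuation takes the value oo. *)
Definition cnt s (x : X) : nat := count (fun U => x \in (U : set X)) s.

Fixpoint chain_ins U s : seq (opens X) :=
  if s is C :: s' then opensU U C :: chain_ins (opensI U C) s' else [:: U].

Definition chainify s := foldr chain_ins [::] s.

Definition usum nu s : \bar R := \sum_(U <- s) nu U.

Lemma usum_ge0 nu s : 0 <= usum nu s.
Proof. by apply: sume_ge0. Qed.

Lemma usum_ins nu U s : usum nu (chain_ins U s) = nu U + usum nu s.
Proof.
rewrite /usum; elim: s U => [|C s IH] U /=; first by rewrite big_seq1 big_nil adde0.
by rewrite !big_cons IH addeA valuation_modular addeA.
Qed.

Lemma usum_chainify nu s : usum nu (chainify s) = usum nu s.
Proof.
elim: s => [//|U s IH] /=; by rewrite usum_ins IH /usum big_cons.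
Qed.

Definition nthO s (k : nat) : set X := nth (opens0 X) s k.

Lemma nth_ins U s x n :
  (forall k, nthO s k x <-> (k < n)%N) ->
  forall k, nthO (chain_ins U s) k x <-> (k < (x \in (U : set X)) + n)%N.
Proof.
rewrite /nthO; elim: s U n => [|C s IH] U n H k /=.
  have n0 : n = 0%N by case: n H => // n /(_ 0%N)/=[_ /(_ isT)].
  rewrite n0 addn0; case: k => [|k] /=.
    by rewrite lt0b classical_sets.in_setE.
  by rewrite nth_nil /=; split => // ; case: (_ \in _).
have C0 : (C : set X) x <-> (0 < n)%N := H 0%N.
have /IH IH' : forall k, nthO s k x <-> (k < n.-1)%N.
  by move=> j; have := H j.+1; rewrite /= -ltn_predRL /=.
case: k => [|k] /=.
  rewrite addn_gt0 lt0b; split => [[Ux|/C0 ->]|/orP[|/C0]].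
  - by rewrite mem_set.
  - by rewrite orbT.
  - by move/set_mem; left.
  - by right.
rewrite IH'/= in_setI.
case: n {H IH IH'} C0 => [|n] C0.
  have -> : x \in (C : set X) = false.
    by apply/negP; rewrite classical_sets.in_setE => /C0.
  by rewrite andbF /= addn0; split => //; case: (_ \in _).
have -> : x \in (C : set X) by rewrite classical_sets.in_setE; apply/C0.
by rewrite andbT /= addnS ltnS.
Qed.

Lemma nth_chainify s x k : nthO (chainify s) k x <-> (k < cnt s x)%N.
Proof.
elim: s k => [|U s IH] k /=; first by rewrite /nthO nth_nil.
exact: nth_ins.
Qed.

Lemma usum_nth nu s n : (size s <= n)%N ->
  usum nu s = \sum_(k < n) nu (nth (opens0 X) s k).
Proof.
move=> sn; rewrite /usum (big_nth (opens0 X)) big_mkord.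
rewrite (big_ord_widen n (fun k => nu (nth (opens0 X) s k) : \bar R))//.
rewrite [RHS](bigID (fun k : 'I_n => (k < size s)%N)) /= [X in _ + X]big1 ?adde0//.
by move=> k; rewrite -leqNgt => ks; rewrite nth_default// valuation0.
Qed.

Lemma usum_le nu s t : (forall x, (cnt s x <= cnt t x)%N) -> usum nu s <= usum nu t.
Proof.
move=> st; rewrite -(usum_chainify nu s) -(usum_chainify nu t).
set n := maxn (size (chainify s)) (size (chainify t)).
rewrite (@usum_nth _ _ n) ?leq_maxl// (@usum_nth _ (chainify t) n) ?leq_maxr//.
apply: lee_sum => k _; apply: valuation_mono => x /nth_chainify ks.
by apply/nth_chainify; exact: leq_trans ks (st x).
Qed.

Definition rep (n : nat) s := flatten (nseq n s).

Lemma cnt_rep n s x : cnt (rep n s) x = (n * cnt s x)%N.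
Proof. by elim: n => //= n IH; rewrite /cnt /rep /= count_cat -/(cnt _ _) [X in (_ + X)%N]IH mulSn. Qed.

Lemma usum_cat nu s t : usum nu (s ++ t) = usum nu s + usum nu t.
Proof. by rewrite /usum big_cat. Qed.

Lemma usum_rep nu n s : usum nu (rep n s) = n%:R%:E * usum nu s.
Proof.
elim: n => [|n IH]; first by rewrite /usum /rep big_nil mul0e.
rewrite /rep /= usum_cat [X in _ + X]IH -natr1 EFinD ge0_muleDl ?lee_fin//.
by rewrite mul1e addeC.
Qed.

Definition dyadic (n k : nat) : R := (k%:R / 2 ^+ n)%R.
(* integral, and value, of 2^-n sum_(U in s) 1_U *)
Definition dsum nu n s : \bar R := (dyadic n 1)%:E * usum nu s.
Definition dyadic_fun n s (x : X) : \bar R := (dyadic n (cnt s x))%:E.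

Lemma dy_ge0 n k : (0 <= dyadic n k)%R.
Proof. by rewrite divr_ge0// exprn_ge0. Qed.

Lemma dyE n k : dyadic n k = (k%:R * dyadic n 1)%R.
Proof. by rewrite /dyadic mul1r. Qed.

Lemma dsum_ge0 nu n s : 0 <= dsum nu n s.
Proof. by rewrite mule_ge0// ?usum_ge0// lee_fin dy_ge0. Qed.

Lemma dy_le m n j k : (dyadic n j <= dyadic m k)%R = (2 ^ m * j <= 2 ^ n * k)%N.
Proof.
have p0 i : (0 < 2 ^+ i :> R)%R by rewrite exprn_gt0.
rewrite /dyadic ler_pdivrMr// mulrAC ler_pdivlMr// -!natrX -!natrM ler_nat.
by rewrite mulnC [X in (_ <= X)%N]mulnC.
Qed.

Lemma dsum_le nu m n s t : (forall x, dyadic_fun n s x <= dyadic_fun m t x) ->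
  dsum nu n s <= dsum nu m t.
Proof.
move=> H; have : usum nu (rep (2 ^ m) s) <= usum nu (rep (2 ^ n) t).
  by apply: usum_le => x; rewrite !cnt_rep -dy_le -lee_fin; exact: H.
have p0 i : (0 < 2 ^+ i :> R)%R by rewrite exprn_gt0.
rewrite !usum_rep !natrX /dsum => H1.
have <- : (dyadic (n + m) 1)%:E * ((2 ^+ m)%:E * usum nu s) = (dyadic n 1)%:E * usum nu s.
  rewrite muleA -EFinM; congr (_%:E * _).
  by rewrite /dyadic exprD !mul1r invfM -mulrA mulVf ?gt_eqF// mulr1.
have <- : (dyadic (n + m) 1)%:E * ((2 ^+ n)%:E * usum nu t) = (dyadic m 1)%:E * usum nu t.
  rewrite muleA -EFinM; congr (_%:E * _).
  by rewrite /dyadic exprD !mul1r invfM mulrAC  mulVf ?gt_eqF// mul1r.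
by apply: lee_wpmul2l => //; rewrite lee_fin dy_ge0.
Qed.

Lemma dsum_cat nu n s t : dsum nu n (s ++ t) = dsum nu n s + dsum nu n t.
Proof. by rewrite /dsum usum_cat ge0_muleDr ?usum_ge0. Qed.

Lemma dfun_cat n s t x : dyadic_fun n (s ++ t) x = dyadic_fun n s x + dyadic_fun n t x.
Proof. by rewrite /dyadic_fun /dyadic /cnt count_cat natrD mulrDl EFinD. Qed.

End valuation_lemmas.
#[global] Hint Resolve valuation_ge0 : core.

Section truncation.
Variable R : realType.
Implicit Types (y : \bar R) (m k N : nat).
Local Notation dy := (@dyadic R).

(* min(N, ceil(2^m y) - 1) for 0 < y *)
Definition qd m N y : nat := count (fun k => (dy m k.+1)%:E < y) (iota 0 N).

Lemma dy_mono m j k : (j <= k)%N -> (dy m j <= dy m k)%R.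
Proof. by move=> jk; rewrite dy_le leq_pmul2l// expn_gt0. Qed.

Lemma ltqd m N y k : (k < qd m N y)%N = (k < N)%N && ((dy m k.+1)%:E < y).
Proof.
rewrite /qd; elim: N k => [//|N IH] k.
have -> : iota 0 N.+1 = iota 0 N ++ [:: N] by rewrite -addn1 iotaD.
rewrite count_cat /= addn0.
case: (boolP ((dy m N.+1)%:E < y)) => Ny.
  have down j : (j <= N)%N -> (dy m j.+1)%:E < y.
    move=> jN; apply: le_lt_trans Ny; rewrite lee_fin; exact: dy_mono.
  have /eqP -> : count (fun k => (dy m k.+1)%:E < y) (iota 0 N) == N.
    rewrite -[X in _ == X](size_iota 0 N) -all_count; apply/allP => j.
    by rewrite mem_iota add0n => /andP[_ /ltnW]; exact: down.
  rewrite /= addn1 ltnS; case: (leqP k N) => //= kN.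
  by rewrite down.
rewrite /= addn0 IH ltnS; case: (ltngtP k N) => [//|//|->].
by rewrite (negbTE Ny).
Qed.

Lemma qd_lt m N y : 0 < y -> (dy m (qd m N y))%:E < y.
Proof.
move=> y0; case E : (qd m N y) => [|k]; first by rewrite /dyadic mul0r.
by have := ltqd m N y k; rewrite E leqnn => /esym /andP[].
Qed.

Lemma qd_le m N y : 0 <= y -> (dy m (qd m N y))%:E <= y.
Proof.
rewrite le_eqVlt => /predU1P[<-|/qd_lt/ltW//].
case E : (qd m N 0) => [|k]; first by rewrite /dyadic mul0r.
have := ltqd m N 0 k; rewrite E leqnn => /esym /andP[_].
by rewrite lte_fin ltNge dy_ge0.
Qed.

Lemma qd_gt N m y k : (k <= N)%N -> (k == 0)%N || ((dy m k)%:E < y) -> (k <= qd m N y)%N.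
Proof. by case: k => [//|k] kN /= ky; rewrite ltqd kN. Qed.

Lemma dy_double m n k : (m <= n)%N -> dy m k = dy n (2 ^ (n - m) * k).
Proof.
move=> mn; apply/eqP; rewrite eq_le !dy_le !mulnA -!expnD.
by rewrite subnKC// leqnn.
Qed.

Definition qt m y := qd m (4 ^ m) y.

Lemma qt_mono m n y : (m <= n)%N -> (dy m (qt m y) <= dy n (qt n y))%R.
Proof.
move=> mn; rewrite (dy_double _ mn); apply: dy_mono; apply: qd_gt.
  apply: (@leq_trans (2 ^ (n - m) * 4 ^ m)).
    rewrite leq_pmul2l ?expn_gt0//.
    rewrite /qt /qd; apply: leq_trans (count_size _ _) _; by rewrite size_iota.
  rewrite -[X in (_ <= 4 ^ X)%N](subnK mn) expnD leq_pmul2r ?expn_gt0//.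
  by case: (n - m)%N => [|e] //; rewrite leq_exp2r.
rewrite -(dy_double _ mn) muln_eq0.
have [->|q0] := eqVneq (qt m y) 0%N; first by rewrite orbT.
apply/orP; right; have := ltqd m (4 ^ m) y (qt m y).-1.
rewrite prednK ?lt0n// -/(qt m y) leqnn => /esym.
by move=> /andP[].
Qed.

Lemma qt_sup y (a : R) : (0 <= a)%R -> a%:E < y -> exists m, (a <= dy m (qt m y))%R.
Proof.
move=> a0 ay.
have [b ab byy] : exists2 b : R, (a < b)%R & b%:E < y.
  case: y ay => [y||] //= ay.
    by exists ((a + y) / 2)%R; rewrite ?lte_fin ?midf_lt.
  by exists (a + 1)%R; rewrite ?ltrDl ?ltry.
have ba : (0 < b - a)%R by rewrite subr_gt0.
pose c := Num.max b (b - a)^-1%R.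
have c0 : (0 <= c)%R by rewrite le_max invr_ge0 (ltW ba) orbT.
pose m := Num.bound c; exists m.
have cm : (c < 2 ^+ m)%R.
  apply: lt_trans (archi_boundP c0) _.
  by rewrite -natrX ltr_nat ltn_expl.
have p0 : (0 < 2 ^+ m :> R)%R by rewrite exprn_gt0.
have a2 : (0 <= 2 ^+ m * a)%R by rewrite mulr_ge0// ltW.
pose k := Num.truncn (2 ^+ m * a)%R.
have /andP[k1 k2] := truncn_itv a2.
rewrite -/k in k1 k2.
have ka : (a <= dy m k.+1)%R by rewrite /dyadic ler_pdivlMr// mulrC ltW.
apply: le_trans ka _; apply: dy_mono; rewrite ltqd; apply/andP; split.
  rewrite -(ltr_nat R); apply: le_lt_trans k1 _.
  rewrite (_ : 4 ^ m = 2 ^ m * 2 ^ m)%N; last by rewrite -expnMn.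
  rewrite natrM natrX ltr_pM2l//; apply: lt_trans cm.
  by rewrite lt_max ab.
apply: le_lt_trans byy; rewrite lee_fin /dyadic ler_pdivrMr// mulrC.
rewrite -natr1; apply: (@le_trans _ _ (2 ^+ m * a + 1)%R); first by rewrite lerD2r.
rewrite -lerBrDl -mulrBr -ler_pdivrMr// mul1r ltW//; apply: le_lt_trans cm.
by rewrite le_max lexx orbT.
Qed.

Lemma qt_ereal_sup y : 0 <= y ->
  y = ereal_sup [set (dy m (qt m y))%:E | m in [set: nat]].
Proof.
move=> y0; apply/eqP; rewrite eq_le; apply/andP; split; last first.
  by apply: ge_ereal_sup => _ [m _ <-]; exact: qd_le.
rewrite leNgt; apply/negP => H.
set S := ereal_sup _ in H.
have S0 : 0 <= S.
  by apply: ereal_sup_ge0 => [|_ [m _ <-]];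
    [exists (dy 0 (qt 0 y))%:E, 0%N|rewrite lee_fin dy_ge0].
have [a [a0 Sa ay]] : exists a : R, [/\ (0 <= a)%R, S < a%:E & a%:E < y].
  clearbody S; case: S S0 H => [s||]; last by [].
    rewrite lee_fin => s0; case: y {y0} => [y||] //.
      move=> sy; exists ((s + y) / 2)%R; rewrite !lte_fin !midf_lt//.
      by split=> //; apply: le_trans s0 _; rewrite ltW// midf_lt.
    by exists (s + 1)%R; rewrite lte_fin ltrDl ltry; split=> //; rewrite addr_ge0.
  by move=> _; rewrite ltNge leey.
have [m am] := qt_sup a0 ay.
move: Sa; rewrite ltNge => /negP; apply.
by apply: le_ereal_sup_tmp; exists (dy m (qt m y))%:E; [exists m|rewrite lee_fin].
Qed.

Lemma ereal_sup_mulr (u : nat -> R) (v : \bar R) : (forall m, 0 <= u m)%R ->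
  0 <= v -> ereal_sup [set (u m)%:E | m in [set: nat]] * v =
  ereal_sup [set (u m)%:E * v | m in [set: nat]].
Proof.
move=> u0 v0; set S := ereal_sup _.
have uS m : (u m)%:E <= S by apply: ereal_sup_ubound; exists m.
have S0 : 0 <= S by apply: le_trans (uS 0%N); rewrite lee_fin.
apply/eqP; rewrite eq_le; apply/andP; split; last first.
  by apply: ge_ereal_sup => _ [m _ <-]; apply: lee_wpmul2r.
move: v0; rewrite [0 <= v]le_eqVlt => /predU1P[<-|v0].
  rewrite mule0; apply: le_ereal_sup_tmp; exists ((u 0%N)%:E * 0); last by rewrite mule0.
  by exists 0%N; rewrite ?mule0.
case: v v0 => [v||] // v0.
  rewrite muleC -ereal_sup_pZl//; apply: ereal_sup_le => _ [_ [m _ <-] <-].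
  by exists m => //; rewrite muleC.
move: S0; rewrite [0 <= S]le_eqVlt => /predU1P[<-|S0].
  rewrite mul0e; apply: le_ereal_sup_tmp; exists ((u 0%N)%:E * +oo).
    by exists 0%N.
  by rewrite mule_ge0// lee_fin.
have [_ [m _ <-] um] := ereal_sup_gt S0.
rewrite ereal_supy ?leey//; exists m => //; by rewrite gt0_muley.
Qed.

End truncation.

Section lower_semicontinuous_functions.
Variables (R : realType) (X : topologicalType).
Implicit Types (f g h : lsc R X) (s t : seq (opens X)).
Local Notation dfun := (@dyadic_fun R X).

Lemma uereal_val_inj (x y : uereal R) : x = y :> \bar R -> x = y.
Proof. exact: val_inj. Qed.

Lemma open_upper_ray (r : R) : open [set y : uereal R | r%:E < y].
Proof.
have [r0|r0] := leP 0%R r; first by constructor 3; exists r.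
rewrite (_ : [set _ | _] = setT); first exact: openT.
apply/seteqP; split => // y _ /=; apply: lt_le_trans (uereal_ge0 y).
by rewrite lte_fin.
Qed.

Lemma open_lsc g (r : R) : open [set x | r%:E < g x].
Proof.
apply: (@open_comp _ _ g [set y : uereal R | r%:E < y]); last exact: open_upper_ray.
by move=> x _; exact: cts_fun.
Qed.

Lemma lsc_continuous (g : X -> uereal R) :
  (forall r : R, (0 <= r)%R -> open [set x | r%:E < g x]) -> continuous g.
Proof.
move=> H; apply/continuousP => A [->|->|[r r0 ->]].
- by rewrite preimage_set0; exact: open0.
- by rewrite preimage_setT; exact: openT.
- exact: H.
Qed.

Definition lev g (r : R) : opens X := Opens (open_lsc g r).
Definition levs m N g := [seq lev g (dyadic R m k.+1) | k <- iota 0 N].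
Definition tlevs m g := levs m (4 ^ m) g.

Lemma cnt_levs m N g x : cnt (levs m N g) x = qd m N (g x).
Proof.
rewrite /cnt /levs /qd count_map; apply: eq_count => k /=.
by apply/idP/idP => [/set_mem|/mem_set].
Qed.

Lemma dfun_tlevs m g x : dfun m (tlevs m g) x = (dyadic R m (qt m (g x)))%:E.
Proof. by rewrite /dyadic_fun cnt_levs. Qed.

Lemma dfun_ge0 m s x : 0 <= dfun m s x.
Proof. by rewrite lee_fin dy_ge0. Qed.

Lemma open_dfun m s (r : R) : (0 <= r)%R -> open [set x | r%:E < dfun m s x].
Proof.
move=> r0; rewrite (_ : [set _ | _] = \bigcup_(k in [set k | (r < dyadic R m k.+1)%R])
    nthO (chainify s) k).
  by apply: bigcup_open => k _; exact: opensP.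
apply/seteqP; split => x /=.
  rewrite lte_fin => rs; have c0 : (0 < cnt s x)%N.
    by rewrite lt0n; apply/negP => /eqP c0; move: rs; rewrite c0 /dyadic mul0r ltNge r0.
  exists (cnt s x).-1; first by rewrite /= prednK.
  by apply/nth_chainify; rewrite prednK.
move=> [k /= rk /nth_chainify kc]; rewrite lte_fin; apply: lt_le_trans rk _.
exact: dy_mono.
Qed.

Definition dlsc_fun m s x : uereal R := UEreal (dfun_ge0 m s x).

Lemma dlsc_continuous m s : continuous (dlsc_fun m s).
Proof. by apply: lsc_continuous => r; exact: open_dfun. Qed.

Definition dlsc m s : lsc R X := mkcts (@dlsc_continuous m s).

Lemma dlscE m s x : dlsc m s x = dfun m s x :> \bar R.
Proof. by []. Qed.

Definition lscD_fun f g x : uereal R :=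
  UEreal (adde_ge0 (uereal_ge0 (f x)) (uereal_ge0 (g x))).

Lemma lscD_sup f g x : (f x : \bar R) + g x =
  ereal_sup [set dfun m (tlevs m f ++ tlevs m g) x | m in [set: nat]].
Proof.
under eq_imagel do rewrite dfun_cat !dfun_tlevs.
rewrite ereal_sup_dirD; first by rewrite -!qt_ereal_sup ?uereal_ge0.
- by exists 0%N.
- by move=> i _; rewrite lee_fin dy_ge0.
- by move=> i _; rewrite lee_fin dy_ge0.
- move=> i j _ _; exists (maxn i j).
  by rewrite !lee_fin !qt_mono ?leq_maxl ?leq_maxr.
Qed.

Lemma lscD_continuous f g : continuous (lscD_fun f g).
Proof.
apply: lsc_continuous => r r0.
rewrite (_ : [set _ | _] =
  \bigcup_m [set x | r%:E < dfun m (tlevs m f ++ tlevs m g) x]).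
  by apply: bigcup_open => m _; exact: open_dfun.
apply/seteqP; split => x /=; rewrite lscD_sup.
  by move=> /ereal_sup_gt[_ [m _ <-] rm]; exists m.
move=> [m _ /= rm]; apply: lt_le_trans rm _; apply: ereal_sup_ubound.
by exists m.
Qed.

Definition lscD f g : lsc R X := mkcts (@lscD_continuous f g).

Lemma lscDE f g x : lscD f g x = (f x : \bar R) + g x :> \bar R.
Proof. by []. Qed.

Lemma lsc_sup f x : (f x : \bar R) =
  ereal_sup [set (dlsc m (tlevs m f) x : \bar R) | m in [set: nat]].
Proof.
under eq_imagel do rewrite dlscE dfun_tlevs.
exact: qt_ereal_sup (uereal_ge0 _).
Qed.

End lower_semicontinuous_functions.

Section integral_theory.
Variables (R : realType) (X : topologicalType).
Implicit Types (nu : valuation R X) (f g h : lsc R X) (s t : seq (opens X)).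
Local Notation dfun := (@dyadic_fun R X).

Lemma integral_mono nu f g : (forall x, (f x : \bar R) <= g x) ->
  (integral nu f : \bar R) <= integral nu g.
Proof.
move=> fg; apply: ereal_sup_le => _ [l [l0 lf] <-]; exists l => //; split => // x.
exact: le_trans (lf x) (fg x).
Qed.

Lemma eq_integral nu f g : (forall x, f x = g x :> \bar R) ->
  integral nu f = integral nu g.
Proof.
move=> fg; apply: uereal_val_inj; apply/eqP; rewrite eq_le.
by rewrite !integral_mono// => x; rewrite fg.
Qed.

Lemma dy1_gt0 m : (0 < dyadic R m 1)%R.
Proof. by rewrite /dyadic mul1r invr_gt0 exprn_gt0. Qed.

Definition weighted m s : seq (\bar R * opens X) :=
  [seq ((dyadic R m 1)%:E, U) | U <- s].

Lemma simple_fun_weighted m s x : simple_fun (weighted m s) x = dfun m s x.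
Proof.
rewrite /simple_fun /weighted big_map /= /dyadic_fun.
elim: s => [|U s IH]; first by rewrite big_nil /cnt /dyadic mul0r.
rewrite big_cons IH /cnt /= -EFinM -EFinD; congr _%:E.
by rewrite [in RHS]/dyadic natrD mulrDl indicE -/(dyadic _ _ _) mulrC [in RHS]/= -dyE.
Qed.

Lemma simple_integral_weighted nu m s :
  simple_integral nu (weighted m s) = dsum nu m s.
Proof.
rewrite /simple_integral /weighted big_map /= /dsum /usum.
by rewrite ge0_sume_distrr// => U _; exact: valuation_ge0.
Qed.

Lemma dsum_le_integral nu m s g : (forall x, dfun m s x <= g x) ->
  dsum nu m s <= integral nu g.
Proof.
move=> sg; apply: ereal_sup_ubound; exists (weighted m s).
  split; last by move=> x; rewrite simple_fun_weighted.
  by apply/allP => _ /mapP[U _ ->] /=; rewrite lte_fin dy1_gt0.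
exact: simple_integral_weighted.
Qed.

Definition trunc_simple m (l : seq (\bar R * opens X)) : seq (opens X) :=
  flatten [seq nseq (qt m p.1) p.2 | p <- l].

Lemma usum_nseq nu n (U : opens X) : usum nu (nseq n U) = n%:R%:E * nu U.
Proof.
elim: n => [|n IH]; first by rewrite /usum big_nil mul0e.
rewrite /usum /= big_cons -/(usum _ _) IH -natr1 EFinD ge0_muleDl ?lee_fin//.
by rewrite mul1e addeC.
Qed.

Lemma dsum_trunc nu m l :
  dsum nu m (trunc_simple m l) = \sum_(p <- l) (dyadic R m (qt m p.1))%:E * nu p.2.
Proof.
elim: l => [|p l IH]; first by rewrite /dsum /usum /trunc_simple /= !big_nil mule0.
rewrite big_cons -IH /trunc_simple /= dsum_cat; congr (_ + _).
by rewrite /dsum usum_nseq muleA -EFinM mulrC -dyE.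
Qed.

Lemma simple_fun_ge0 (l : seq (\bar R * opens X)) x :
  all (fun p => 0 < p.1) l -> 0 <= simple_fun l x.
Proof.
move=> /allP l0; rewrite /simple_fun big_seq; apply: sume_ge0 => p /l0 p0.
by rewrite mule_ge0 ?(ltW p0)// lee_fin indicE.
Qed.

Lemma dfun_trunc m l x : all (fun p => 0 < p.1) l ->
  (cnt (trunc_simple m l) x = 0%N) \/ dfun m (trunc_simple m l) x < simple_fun l x.
Proof.
elim: l => [|p l IH] /=; first by left.
move=> /andP[p0 l0]; have {}IH := IH l0; have sl0 := simple_fun_ge0 x l0.
have -> : trunc_simple m (p :: l) = nseq (qt m p.1) p.2 ++ trunc_simple m l by [].
rewrite /simple_fun big_cons -/(simple_fun l x) dfun_cat.
have cE : cnt (nseq (qt m p.1) p.2) x = ((x \in (p.2 : set X)) * qt m p.1)%N.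
  by rewrite /cnt count_nseq.
have cD : cnt (nseq (qt m p.1) p.2 ++ trunc_simple m l) x =
  (cnt (nseq (qt m p.1) p.2) x + cnt (trunc_simple m l) x)%N by rewrite /cnt count_cat.
rewrite cD {1 2}/dyadic_fun cE indicE.
case: (_ \in _); rewrite /= ?mul1n ?mule1 ?mul0n ?mule0 ?add0n ?[dyadic _ _ 0]mul0r ?add0e //.
right; have pq := qd_lt m (4 ^ m) p0.
case: IH => [->|IH]; last exact: lteD.
by rewrite [dyadic _ _ 0]mul0r adde0; apply: lt_le_trans pq _; rewrite leeDl.
Qed.

Lemma simple_integral_le nu g l : simple_below g l ->
  simple_integral nu l <=
  ereal_sup [set dsum nu p.1 (levs p.1 p.2 g) | p in [set: nat * nat]].
Proof.
move=> [l0 lg].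
have -> : simple_integral nu l =
  ereal_sup [set dsum nu m (trunc_simple m l) | m in [set: nat]].
  under eq_imagel do rewrite dsum_trunc.
  rewrite (@ereal_sup_dir_sum _ _ _ l setT (fun i j => (i <= j)%N)
    (fun p m => (dyadic R m (qt m p.1))%:E * nu p.2)).
  - rewrite /simple_integral !big_seq; apply: eq_bigr => p pl.
    rewrite -ereal_sup_mulr ?valuation_ge0//; last by move=> m; exact: dy_ge0.
    by rewrite -qt_ereal_sup// ltW// (allP l0).
  - by exists 0%N.
  - by move=> p i _; rewrite mule_ge0// lee_fin dy_ge0.
  - move=> p i j _ _ ij; apply: lee_wpmul2r; first exact: valuation_ge0.
    by rewrite lee_fin qt_mono.
  - by move=> i j _ _; exists (maxn i j); rewrite leq_maxl leq_maxr.
apply: ge_ereal_sup => _ [m _ <-].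
pose N := size (trunc_simple m l); apply: le_ereal_sup_tmp.
exists (dsum nu m (levs m N g)); first by exists (m, N).
apply: dsum_le => x; rewrite lee_fin; apply: dy_mono.
rewrite cnt_levs; apply: qd_gt; first exact: count_size.
case: (dfun_trunc m x l0) => [->//|H]; apply/orP; right.
exact: lt_le_trans H (lg x).
Qed.

Lemma integralE nu g : integral nu g =
  ereal_sup [set dsum nu p.1 (levs p.1 p.2 g) | p in [set: nat * nat]] :> \bar R.
Proof.
apply/eqP; rewrite eq_le; apply/andP; split.
  by apply: ge_ereal_sup => _ [l lg <-]; exact: simple_integral_le.
apply: ge_ereal_sup => _ [[m N] _ <-] /=; apply: dsum_le_integral => x.
by rewrite /dyadic_fun cnt_levs; apply: qd_le; exact: uereal_ge0.
Qed.

Lemma integral_sup nu (T : Type) (D : set T) (G : T -> lsc R X) g :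
  D !=set0 ->
  (forall i j, D i -> D j -> exists k, [/\ D k,
    forall x, (G i x : \bar R) <= G k x & forall x, (G j x : \bar R) <= G k x]) ->
  (forall x, g x = ereal_sup [set (G i x : \bar R) | i in D] :> \bar R) ->
  integral nu g = ereal_sup [set (integral nu (G i) : \bar R) | i in D] :> \bar R.
Proof.
move=> D0 dir gE; apply/eqP; rewrite eq_le; apply/andP; split; last first.
  apply: ge_ereal_sup => _ [i Di <-]; apply: integral_mono => x.
  by rewrite gE; apply: ereal_sup_ubound; exists i.
rewrite integralE; apply: ge_ereal_sup => _ [[m N] _ <-] /=.
have -> : dsum nu m (levs m N g) = ereal_sup [set dsum nu m (levs m N (G i)) | i in D].
  rewrite /dsum /usum.
  have E h : \sum_(U <- levs m N h) (nu U : \bar R) =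
    \sum_(k <- iota 0 N) nu (lev h (dyadic R m k.+1)) by rewrite /levs big_map.
  under eq_imagel do rewrite E; rewrite E.
  transitivity ((dyadic R m 1)%:E * ereal_sup
    [set \sum_(k <- iota 0 N) (nu (lev (G i) (dyadic R m k.+1)) : \bar R) | i in D]).
    congr (_ * _).
    rewrite (@ereal_sup_dir_sum _ _ _ (iota 0 N) D
      (fun i j => forall x, (G i x : \bar R) <= G j x)
      (fun k i => nu (lev (G i) (dyadic R m k.+1)) : \bar R)) //.
      apply: eq_bigr => k _; set r := dyadic R m k.+1.
      pose F := [set lev (G i) r | i in D].
      have -> : lev g r = opens_bigcup F.
        apply: opens_eqP; apply/seteqP; split => x /=.
          rewrite gE => /ereal_sup_gt[_ [i Di <-] ri].
          by exists (lev (G i) r) => //; exists i.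
        move=> [_ [i Di <-]] /= ri; rewrite gE; apply: lt_le_trans ri _.
        by apply: ereal_sup_ubound; exists i.
      rewrite valuation_directed; first by rewrite /F image_comp.
      split; first by have [i Di] := D0; exists (lev (G i) r), i.
      move=> _ _ [i Di <-] [j Dj <-]; have [k' [Dk ik jk]] := dir i j Di Dj.
      exists (lev (G k') r); first by exists k'.
      by split => x /= rx; apply: lt_le_trans rx _.
    move=> k i j _ _ ij; apply: valuation_mono => x /= rx.
    exact: lt_le_trans rx _.
  rewrite -ereal_sup_pZl ?dy1_gt0//; congr ereal_sup.
  by rewrite image_comp.
apply: ge_ereal_sup => _ [i Di <-]; apply: le_ereal_sup_tmp.
exists (integral nu (G i)); first by exists i.
by rewrite integralE; apply: ereal_sup_ubound; exists (m, N).
Qed.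

Lemma integral_dlsc nu m s : integral nu (dlsc R m s) = dsum nu m s :> \bar R.
Proof.
apply/eqP; rewrite eq_le dsum_le_integral// andbT integralE.
apply: ge_ereal_sup => _ [[n N] _ <-] /=; apply: dsum_le => x.
rewrite [leLHS]/dyadic_fun cnt_levs -dlscE; exact: qd_le (uereal_ge0 _).
Qed.

Lemma dlsc_dir (t : nat -> seq (opens X)) :
  (forall i j x, (i <= j)%N -> dfun i (t i) x <= dfun j (t j) x) ->
  forall i j, [set: nat] i -> [set: nat] j -> exists k, [/\ [set: nat] k,
    forall x, (dlsc R i (t i) x : \bar R) <= dlsc R k (t k) x &
    forall x, (dlsc R j (t j) x : \bar R) <= dlsc R k (t k) x].
Proof.
move=> H i j _ _; exists (maxn i j); split => // x; apply: H.
  exact: leq_maxl.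
exact: leq_maxr.
Qed.

Lemma tlevs_mono g i j x : (i <= j)%N ->
  dfun i (tlevs i g) x <= dfun j (tlevs j g) x.
Proof. by move=> ij; rewrite !dfun_tlevs lee_fin qt_mono. Qed.

Lemma integral_tlevs nu g : integral nu g =
  ereal_sup [set dsum nu m (tlevs m g) | m in [set: nat]] :> \bar R.
Proof.
rewrite (@integral_sup nu nat setT (fun m => dlsc R m (tlevs m g))).
- by under eq_imagel do rewrite integral_dlsc.
- by exists 0%N.
- by apply: (@dlsc_dir (fun m => tlevs m g)) => i j x; exact: tlevs_mono.
- exact: lsc_sup.
Qed.

Lemma integralD nu f g : integral nu (lscD f g) =
  (integral nu f : \bar R) + integral nu g :> \bar R.
Proof.
rewrite (@integral_sup nu nat setT
  (fun m => dlsc R m (tlevs m f ++ tlevs m g))).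
- under eq_imagel do rewrite integral_dlsc dsum_cat.
  rewrite (integral_tlevs nu f) (integral_tlevs nu g) ereal_sup_dirD//.
  + by move=> i _; exact: dsum_ge0.
  + by move=> i _; exact: dsum_ge0.
  + move=> i j _ _; exists (maxn i j); split => //.
      by apply: dsum_le => x; apply: tlevs_mono; exact: leq_maxl.
    by apply: dsum_le => x; apply: tlevs_mono; exact: leq_maxr.
- by exists 0%N.
- apply: (@dlsc_dir (fun m => tlevs m f ++ tlevs m g)) => i j x ij.
  by rewrite !dfun_cat; apply: leeD; exact: tlevs_mono.
- exact: lscD_sup.
Qed.

Lemma integralZ_le nu f g (c : R) : (0 < c)%R ->
  (forall x, g x = c%:E * f x :> \bar R) ->
  c%:E * integral nu f <= integral nu g.
Proof.
move=> c0 gE; rewrite /= /integral_val -ereal_sup_pZl//.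
apply: ge_ereal_sup => _ [_ [l [l0 lf] <-] <-].
have lp p : p \in l -> 0 <= p.1 by move=> pl; rewrite ltW// (allP l0).
apply: ereal_sup_ubound; exists [seq (c%:E * p.1, p.2) | p <- l].
  split.
    by rewrite all_map; apply: sub_all l0 => p /= p0; rewrite mule_gt0.
  move=> x; rewrite /simple_fun big_map gE.
  apply: le_trans (lee_wpmul2l _ (lf x)); last by rewrite lee_fin ltW.
  rewrite /simple_fun big_seq [in leRHS]big_seq ge0_sume_distrr.
    by under eq_bigr do rewrite /= -muleA.
  by move=> p pl; rewrite mule_ge0 ?lp// lee_fin indicE.
rewrite /simple_integral big_map big_seq [in RHS]big_seq ge0_sume_distrr.
  by under eq_bigr do rewrite /= -muleA.
by move=> p pl; apply: mule_ge0; [exact: lp|exact: valuation_ge0].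
Qed.

Lemma integralZ nu f g (c : R) : (0 < c)%R ->
  (forall x, g x = c%:E * f x :> \bar R) ->
  integral nu g = c%:E * integral nu f :> \bar R.
Proof.
move=> c0 gE; apply/eqP; rewrite eq_le (integralZ_le _ c0 gE) andbT.
rewrite -[leLHS]mul1e -(@divff _ c) ?gt_eqF// EFinM -muleA.
apply: lee_wpmul2l; first by rewrite lee_fin ltW.
apply: integralZ_le => [|x]; first by rewrite invr_gt0.
by rewrite gE muleA -EFinM mulVf ?gt_eqF// mul1e.
Qed.

End integral_theory.

Section dirac.
Variables (R : realType) (X : topologicalType) (x : X).

Lemma dirac_ge0 (U : opens X) : 0 <= (\1_(U : set X) x : R)%:E.
Proof. by rewrite lee_fin indicE. Qed.

Definition dirac_fun (U : opens X) : uereal R := UEreal (dirac_ge0 U).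

Lemma dirac0 : dirac_fun (opens0 X) = 0 :> \bar R.
Proof. by rewrite /= indic0. Qed.

Lemma dirac_modular (U W : opens X) :
  dirac_fun (opensU U W) + dirac_fun (opensI U W) =
  dirac_fun U + dirac_fun W :> \bar R.
Proof.
rewrite /= -!EFinD !indicE in_setU in_setI; congr _%:E.
by case: (_ \in _); case: (_ \in _); rewrite ?addr0 ?add0r.
Qed.

Lemma dirac_directed (D : set (opens X)) : directed_opens D ->
  dirac_fun (opens_bigcup D) =
  ereal_sup [set (dirac_fun U : \bar R) | U in D] :> \bar R.
Proof.
move=> [[U0 DU0] _]; apply/eqP; rewrite eq_le; apply/andP; split; last first.
  apply: ge_ereal_sup => _ [U DU <-]; rewrite /= lee_fin !indicE ler_nat.
  case: (boolP (x \in (U : set X))) => // /set_mem Ux.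
  by rewrite mem_set//; exists U.
rewrite /= indicE; case: (boolP (_ \in _)) => [/set_mem[U DU Ux]|_].
  apply: le_ereal_sup_tmp; exists (dirac_fun U); first by exists U.
  by rewrite /= lee_fin indicE mem_set.
apply: le_ereal_sup_tmp; exists (dirac_fun U0); first by exists U0.
exact: dirac_ge0.
Qed.

Definition valuation_unit : valuation R X :=
  Valuation dirac0 dirac_modular dirac_directed.

End dirac.

Section pushforward.
Variables (R : realType) (X Y : topologicalType).
Variables (f : continuousType X Y) (nu : valuation R X).

Definition pushforward_fun (U : opens Y) : uereal R := nu (opens_preimage f U).

Lemma pushforward0 : pushforward_fun (opens0 Y) = 0 :> \bar R.
Proof.
rewrite /pushforward_fun -(valuation0 nu); congr (uereal_val (nu _)).
exact: opens_eqP.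
Qed.

Lemma pushforward_modular (U W : opens Y) :
  pushforward_fun (opensU U W) + pushforward_fun (opensI U W) =
  pushforward_fun U + pushforward_fun W :> \bar R.
Proof.
rewrite /pushforward_fun -[RHS]valuation_modular.
have -> : opens_preimage f (opensU U W) =
    opensU (opens_preimage f U) (opens_preimage f W) by exact: opens_eqP.
have -> // : opens_preimage f (opensI U W) =
    opensI (opens_preimage f U) (opens_preimage f W).
exact: opens_eqP.
Qed.

Lemma pushforward_directed (D : set (opens Y)) : directed_opens D ->
  pushforward_fun (opens_bigcup D) =
  ereal_sup [set (pushforward_fun U : \bar R) | U in D] :> \bar R.
Proof.
move=> [[U0 DU0] dD]; rewrite /pushforward_fun.
have -> : opens_preimage f (opens_bigcup D) =
    opens_bigcup [set opens_preimage f U | U in D].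
  apply: opens_eqP; apply/seteqP; split => x /=.
    by move=> [U DU Ux]; exists (opens_preimage f U) => //; exists U.
  by move=> [_ [U DU <-] Ux]; exists U.
rewrite valuation_directed; first by rewrite image_comp.
split; first by exists (opens_preimage f U0), U0.
move=> _ _ [U DU <-] [W DW <-]; have [Z DZ [UZ WZ]] := dD U W DU DW.
exists (opens_preimage f Z); first by exists Z.
by split => x /=; [exact: UZ|exact: WZ].
Qed.

Definition valuation_map : valuation R Y :=
  Valuation pushforward0 pushforward_modular pushforward_directed.

End pushforward.

Definition integral_lsc (R : realType) (X : topologicalType) (g : lsc R X) :
  lsc R (valuation R X) := mkcts (@integral_continuous R X g).

Section multiplication.
Variables (R : realType) (X : topologicalType) (xi : valuation R (valuation R X)).

Definition eval_lsc (U : opens X) : lsc R (valuation R X) :=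
  integral_lsc (dlsc R 0 [:: U]).

Lemma eval_lscE U (nu : valuation R X) : eval_lsc U nu = nu U :> \bar R.
Proof.
rewrite [LHS]integral_dlsc /dsum /usum big_seq1 /dyadic expr0 divr1.
by rewrite mul1e.
Qed.

Definition mult_fun (U : opens X) : uereal R := integral xi (eval_lsc U).

Lemma mult0 : mult_fun (opens0 X) = 0 :> \bar R.
Proof.
rewrite /mult_fun (eq_integral xi (g := dlsc R 0 [::])).
  by rewrite integral_dlsc /dsum /usum big_nil mule0.
by move=> nu; rewrite eval_lscE valuation0 dlscE /dyadic_fun /dyadic mul0r.
Qed.

Lemma mult_modular (U W : opens X) :
  mult_fun (opensU U W) + mult_fun (opensI U W) =
  mult_fun U + mult_fun W :> \bar R.
Proof.
rewrite /mult_fun -!integralD; congr uereal_val; apply: eq_integral => nu.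
by rewrite !lscDE !eval_lscE valuation_modular.
Qed.

Lemma mult_directed (D : set (opens X)) : directed_opens D ->
  mult_fun (opens_bigcup D) =
  ereal_sup [set (mult_fun U : \bar R) | U in D] :> \bar R.
Proof.
move=> dD; rewrite /mult_fun.
rewrite (@integral_sup _ _ xi _ D eval_lsc)//; first by case: dD.
- move=> U W DU DW; have [Z DZ [UZ WZ]] := dD.2 U W DU DW.
  by exists Z; split => // nu; rewrite !eval_lscE; exact: valuation_mono.
- move=> nu; rewrite eval_lscE valuation_directed//; congr ereal_sup.
  by apply: eq_imagel => U _; rewrite eval_lscE.
Qed.

Lemma valuation_mult_exists : exists mu : valuation R X, forall g : lsc R X,
  integral mu g = integral xi (integral_lsc g).
Proof.
exists (Valuation mult0 mult_modular mult_directed) => g.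
apply: uereal_val_inj; rewrite integral_tlevs.
rewrite (@integral_sup _ _ xi _ setT (fun m => integral_lsc (dlsc R m (tlevs m g)))).
- congr ereal_sup; apply: eq_imagel => m _; set s := tlevs m g.
  rewrite /dsum; have -> : usum (Valuation mult0 mult_modular mult_directed) s =
      integral xi (integral_lsc (dlsc R 0 s)).
    elim: s => [|U s IH].
      rewrite /usum big_nil (eq_integral xi (g := dlsc R 0 [::])).
        by rewrite integral_dlsc /dsum /usum big_nil mule0.
      by move=> nu; rewrite [LHS]integral_dlsc /dsum /usum big_nil mule0
        dlscE /dyadic_fun /dyadic mul0r.
    transitivity (integral xi
        (lscD (eval_lsc U) (integral_lsc (dlsc R 0 s))) : \bar R).
      by rewrite /usum big_cons -/(usum _ _) IH integralD.
    congr uereal_val; apply: eq_integral => nu.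
    rewrite lscDE eval_lscE [RHS]integral_dlsc [X in _ + X]integral_dlsc.
    by rewrite /dsum /usum big_cons /dyadic expr0 divr1 !mul1e.
  apply/esym/integralZ; first exact: dy1_gt0.
  move=> nu; rewrite [LHS]integral_dlsc; congr (_ * _).
  by rewrite [RHS]integral_dlsc /dsum /dyadic expr0 divr1 mul1e.
- by exists 0%N.
- move=> i j _ _.
  have [k [_ ik jk]] := dlsc_dir (fun i j x => @tlevs_mono R X g i j x) (i:=i) (j:=j) I I.
  by exists k; split => // nu; exact: integral_mono.
- move=> nu; rewrite [LHS]integral_tlevs; congr ereal_sup.
  by apply: eq_imagel => m _; rewrite [RHS]integral_dlsc.
Qed.

(* E xi is the valuation determined (see valuation_eqP) by
   <E xi, g> = <xi, rho |-> <rho, g>>. *)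
Definition valuation_mult : valuation R X := projT1 (cid valuation_mult_exists).

Lemma integral_valuation_mult (g : lsc R X) :
  integral valuation_mult g = integral xi (integral_lsc g).
Proof. exact: projT2 (cid valuation_mult_exists) g. Qed.

End multiplication.

Lemma valuation_eqP (R : realType) (X : topologicalType) (mu nu : valuation R X) :
  (forall g : lsc R X, integral mu g = integral nu g) -> mu = nu.
Proof.
move=> H; have E : valuation_fun mu = valuation_fun nu.
  apply/funext => U; apply: uereal_val_inj.
  by rewrite -!eval_lscE; congr uereal_val; exact: H.
case: mu nu E {H} => [f f0 fm fd] [g g0 gm gd] /= E; subst g.
by congr Valuation; exact: Prop_irrelevance.
Qed.

Section support.
Variables (R : realType) (X : topologicalType) (nu : valuation R X).

Definition null_opens : opens X :=
  opens_bigcup [set U | nu U = 0 :> \bar R].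

Definition supp : closeds X := Closeds (open_closedC (opensP null_opens)).

Lemma valuation_null_opens : nu null_opens = 0 :> \bar R.
Proof.
rewrite valuation_directed.
  rewrite [X in ereal_sup X](_ : _ = [set 0]) ?ereal_sup1//.
  apply/seteqP; split => [_ [U U0 <-]//|_ ->].
  by exists (opens0 X); rewrite /= ?valuation0.
split; first by exists (opens0 X); exact: valuation0.
move=> U W /= U0 W0; exists (opensU U W); last by split => x ?; [left|right].
apply/eqP; rewrite /= eq_le valuation_ge0 andbT.
rewrite (_ : 0 = (nu U : \bar R) + nu W); last by rewrite U0 W0 adde0.
by rewrite -valuation_modular leeDl ?valuation_ge0.
Qed.

Lemma suppP (U : opens X) : supp `&` U !=set0 <-> 0 < nu U.
Proof.
split.
  move=> [x [nx Ux]]; rewrite lt_neqAle valuation_ge0 andbT; apply/negP => /eqP U0.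
  by apply: nx; exists U.
move=> U0; apply/set0P/eqP => E; move: U0; apply/negP; rewrite -leNgt.
rewrite -valuation_null_opens; apply: valuation_mono => x Ux.
by apply: contrapT => nx; have : (supp `&` U) x by []; rewrite E.
Qed.

End support.

(* Main.v *)
Require Import Defs.
From mathcomp Require Import all_boot all_order all_algebra.
From mathcomp Require Import all_classical all_reals topology.
From mathcomp Require Import ereal numfun.

(** A closed set is determined by the open sets that it meets, and the support
    of nu meets U exactly when 0 < nu U. Each clause therefore becomes a statement
    about when a valuation is positive on an open set.
    - Continuity: the support map pulls the subbasic open set of the closed
      sets meeting U back to [set nu | 0 < nu U], which is open because
      nu |-> nu U is the integral of the indicator of U ([positive_at]).
    - Naturality: (f_* nu) U and nu (f^-1 U) are the same number, and closing up
      a set does not change which open sets it meets ([closure_meets]).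
    - Unit: the Dirac valuation at x is positive on U exactly when U contains x.
    - Multiplication: (E xi) U is the integral of nu |-> nu U against xi. An
      integral is positive exactly when the integrand is positive on a set of
      positive value ([integral_gt0]), so U meets the support of E xi if and only
      if the support of xi meets the open set [set nu | 0 < nu U], that is, if
      and only if some nu in supp xi has a support meeting U. The two closures
      on the other side of the equation are invisible to open sets. *)

Import Order.TTheory GRing.Theory Num.Theory.
Local Open Scope classical_set_scope.
Local Open Scope ring_scope.
Local Open Scope ereal_scope.

(** * Closed sets and the open sets they meet *)

Lemma closure_meets (X : topologicalType) (A U : set X) : open U ->
  closure A `&` U !=set0 <-> A `&` U !=set0.
Proof.
move=> oU; split=> [[x [clAx Ux]]|[x [Ax Ux]]].
  by apply: clAx; exact: open_nbhs_nbhs.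
by exists x; split=> //; exact: subset_closure.
Qed.

(** If the closed set [A] meets only open sets that [B] meets, then [A] misses
    the complement of [B], which is to say that [A] is included in [B]. *)
Lemma closeds_eq_meets (X : topologicalType) (C D : closeds X) :
  (forall U : opens X, C `&` U !=set0 <-> D `&` U !=set0) -> C = D.
Proof.
suff sub (A B : closeds X) :
    (forall U : opens X, A `&` U !=set0 -> B `&` U !=set0) -> A `<=` B.
  move=> H; apply: closeds_eqP; apply/seteqP.
  by split; apply: sub => U /H.
move=> H x Ax; apply: contrapT => nBx.
pose BC := Opens (closed_openC (@closedsP X B)).
have [|y [By nBy]] := H BC; first by exists x.
exact: nBy.
Qed.

Definition meets {X : topologicalType} (U : set X) : set (closeds X) :=
  [set C : closeds X | C `&` U !=set0].

Lemma open_meets (X : topologicalType) (U : set X) : open U -> open (meets U).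
Proof.
move=> oU; exists [set meets U]; last by rewrite bigcup_set1.
by move=> _ ->; exact: (@finI_from1 _ _ (@open X) (@meets X)).
Qed.

(** A basic neighbourhood in the lower Vietoris topology is a finite intersection
    of sets [meets U], and neighbourhood filters absorb finite intersections. *)
Lemma continuous_closeds (T X : topologicalType) (h : T -> closeds X) :
  (forall U : set X, open U -> open (h @^-1` meets U)) -> continuous h.
Proof.
move=> hU t A [_ [[F FI <-] [B FB Bht] FA]].
have /FI[D' D'o DB] := FB.
apply: (@filterS _ (nbhs t) _ (h @^-1` B)).
  by move=> u Bhu; apply: FA; exists B.
rewrite -DB preimage_bigcap; apply: filter_bigI => U UD'.
apply: open_nbhs_nbhs; split; first by apply: hU; exact/set_mem/D'o.
by move: Bht; rewrite -DB; apply.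
Qed.

(** * Positivity of valuations and integrals *)

(** A simple function below [g] vanishes outside [set x | 0 < g x], which
    gives one direction. Conversely [set x | 0 < g x] is the directed union of
    the sets [set x | r < g x] with [0 < r], so by continuity one of these has
    positive value, and [r] times its indicator is below [g]. *)
Lemma integral_gt0 (R : realType) (X : topologicalType) (nu : valuation R X)
    (g : lsc R X) : (0 < integral nu g :> \bar R) <-> 0 < nu (lev g 0).
Proof.
split.
  move=> /ereal_sup_gt[_ [s [/allP s0 sg] <-]] /=.
  rewrite ltNge /simple_integral => /negP s_gt0.
  apply: contrapT => /negP; rewrite -leNgt => g0; apply: s_gt0.
  rewrite big_seq; apply: sume_le0 => p ps; have p0 := s0 _ ps.
  suff -> : nu p.2 = 0 :> \bar R by rewrite mule0.
  apply/eqP; rewrite eq_le valuation_ge0 andbT; apply: le_trans g0.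
  apply: valuation_mono => x px /=; apply: lt_le_trans (sg x).
  rewrite /simple_fun (big_rem p ps) /= indicE mem_set// mule1.
  apply: (lt_le_trans p0); rewrite leeDl// big_seq; apply: sume_ge0 => q.
  by move=> /mem_rem/s0/ltW q0; rewrite mule_ge0// lee_fin indicE.
have -> : lev g 0 = opens_bigcup [set lev g r | r in [set r | (0 < r)%R]].
  apply: opens_eqP; apply/seteqP; split=> x /=.
    case gx : (uereal_val (g x)) => [a||//].
      rewrite lte_fin => a0; exists (lev g (a / 2)%R).
        by exists (a / 2)%R => //=; rewrite divr_gt0.
      by rewrite /= gx lte_fin ltr_pdivrMr// ltr_pMr// ltr1n.
    by move=> _; exists (lev g 1%R); [exists 1%R => //=|rewrite /= gx ltry].
  by move=> [_ [r /= r0 <-]] /=; apply: lt_trans; rewrite lte_fin.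
rewrite valuation_directed; last first.
  split; first by exists (lev g 1%R), 1%R => //=.
  move=> _ _ [a a0 <-] [b b0 <-].
  exists (lev g (Num.min a b)).
    by exists (Num.min a b) => //=; rewrite lt_min a0.
  by split=> x /=; apply: le_lt_trans; rewrite lee_fin ge_min lexx ?orbT.
move=> /ereal_sup_gt[_ [_ [r /= r0 <-] <-] nu0].
apply: (@lt_le_trans _ _ (r%:E * nu (lev g r))); first by rewrite mule_gt0.
apply: ereal_sup_ubound; exists [:: (r%:E, lev g r)].
  split; first by rewrite /= lte_fin r0.
  move=> x; rewrite /simple_fun big_seq1 /= indicE.
  case: (boolP (_ \in _)) => [/set_mem/= /ltW|_]; first by rewrite mule1.
  by rewrite mule0 uereal_ge0.
by rewrite /simple_integral big_seq1.
Qed.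

(** Written as a level set of the evaluation [eval_lsc R U], which makes it open in
    the weak topology and lets [integral_gt0] produce it. *)
Definition positive_at (R : realType) {X : topologicalType} (U : opens X) :
  opens (valuation R X) := lev (eval_lsc R U) 0.

Lemma positive_atP (R : realType) (X : topologicalType) (U : opens X)
    (nu : valuation R X) : (positive_at R U : set _) nu <-> 0 < nu U.
Proof. by rewrite -eval_lscE. Qed.

Lemma valuation_mult_gt0 (R : realType) (X : topologicalType)
    (xi : valuation R (valuation R X)) (U : opens X) :
  0 < valuation_mult xi U <-> 0 < xi (positive_at R U).
Proof.
rewrite /positive_at -integral_gt0.
have <- // : valuation_mult xi U = integral xi (eval_lsc R U) :> \bar R.
by rewrite -(integral_valuation_mult xi); exact: esym (eval_lscE U _).
Qed.

Theorem corollary5p12 (R : realType) :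
  [/\ forall X : topologicalType,
        continuous (@supp R X : valuation R X -> closeds X),
      forall (X Y : topologicalType) (f : continuousType X Y),
        @supp R Y \o valuation_map f = closeds_map f \o @supp R X,
      forall X : topologicalType,
        @supp R X \o @valuation_unit R X = @closeds_unit X &
      forall X : topologicalType,
        @supp R X \o @valuation_mult R X =
        @closeds_mult X \o closeds_map (@supp R X) \o @supp R (valuation R X)].
Proof.
split=> [X|X Y f|X|X].
- apply: continuous_closeds => U oU.
  rewrite (_ : _ @^-1` _ = positive_at R (Opens oU)); first exact: opensP.
  apply/seteqP; split=> nu; last by move=> /positive_atP/suppP.
  by move=> /(suppP nu (Opens oU)) ?; apply/positive_atP.
- apply/funext => nu; apply: closeds_eq_meets => U; rewrite suppP.
  rewrite closure_meets; last exact: opensP.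
  apply: iff_trans (iff_sym (suppP nu (opens_preimage f U))) _; split.
    by move=> [x [nux Ufx]]; exists (f x); split=> //; exists x.
  by move=> [_ [[x nux <-] Ufx]]; exists x.
- apply/funext => x; apply: closeds_eq_meets => U; rewrite suppP.
  rewrite closure_meets; last exact: opensP.
  rewrite /= lte_fin indicE ltr0n lt0b; split=> [/set_mem Ux|[_ [-> Ux]]].
    by exists x.
  exact: mem_set.
- apply/funext => xi; apply: closeds_eq_meets => U.
  rewrite suppP valuation_mult_gt0 -suppP closure_meets; last exact: opensP.
  (* [U] is met by [supp nu] for some [nu] in [supp xi] on both sides. *)
  split.
    move=> [nu [xinu /positive_atP/suppP[x [nux Ux]]]].
    exists x; split=> //; exists (supp nu) => //.
    by apply: subset_closure; exists nu.
  move=> [x [[C KC Cx] Ux]].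
  have /closure_meets[|_ [[nu xinu <-] nuU]] :
      closure (@supp R X @` supp xi) `&` meets U !=set0.
  + by exists C; split; [exact: KC|exists x].
  + exact/open_meets/opensP.
  + by exists nu; split=> //; apply/positive_atP/suppP.
Qed.
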